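(* Let $m$ and $k$ be positive integers with $m\ge 2$ and let $s$ be an integer satisfying $1\le s\le m-1$. The numerical semigroup \[ S_{m,k,s}=\{0,m,2m,\dots,km\}\cup\{n\in\mathbb{N}: n\ge km+s+1\} \] is $\lambda$-minimal.
   Context: $\mathbb{N}=\{0,1,2,\dots\}$. A numerical set is a subset $T\subseteq\mathbb{N}$ with $0\in T$ and finite complement in $\mathbb{N}$. Its gaps are the elements of $\mathrm{G}(T)=\mathbb{N}\setminus T$; the largest gap is the Frobenius number $\mathrm{F}(T)$. A numerical semigroup is a numerical set closed under addition. The enumeration $\lambda(T)$ of a numerical set $T$ is the integer partition whose Young diagram has as its profile (lower-right boundary) the lattice walk that, for $n=0,1,2,\dots,\mathrm{F}(T)$, takes a unit step right if $n\in T$ and a unit step up if $n\notin T$. Equivalently, the parts of $\lambda(T)$ are the numbers $\#\{u\in T: u<x\}$, one for each gap $x\in\mathrm{G}(T)$. The size $|\lambda|$ of a partition is the sum of its parts. The hook length of a box in the Young diagram of a partition $\lambda$ is the number of boxes to its right in the same row plus the number of boxes below it in the same column plus $1$; $\mathrm{H}(\lambda)$ is the set of all hook lengths of $\lambda$. For a numerical semigroup $S$, $\mathcal{P}(S)=\{\lambda:\mathrm{H}(\lambda)=\mathbb{N}\setminus S\}$; it is known that $\lambda(S)\in\mathcal{P}(S)$. $S$ is $\lambda$-minimal if $|\lambda(S)|\le|\lambda|$ for all $\lambda\in\mathcal{P}(S)$. *)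

(* Defs.v *)
From mathcomp Require Import all_boot finmap.
From mathcomp Require Import boolp classical_sets cardinality.

Set Implicit Arguments.
Unset Strict Implicit.
Unset Printing Implicit Defensive.

Local Open Scope classical_set_scope.

Definition numerical_set (T : set nat) : Prop := T 0 /\ finite_set (~` T).

Definition numerical_semigroup (S : set nat) : Prop :=
  numerical_set S /\ (forall a b, S a -> S b -> S (a + b)).

(* A partition is the weakly decreasing list of its (positive) parts, so that
   la has size [sumn la]. *)
Definition is_partition (la : seq nat) : Prop := sorted geq la /\ 0 \notin la.

(* One part #{u in T : u < x} for each gap x of T.  [fset_set] is only
   meaningful on finite sets, hence [T] is meant to be a numerical set. *)
Definition enumeration (T : set nat) : seq nat :=
  sort geq
    [seq #|` fset_set [set u | T u /\ u < x] |%fset | x <- fset_set (~` T)].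

(* Boxes (i, j) are 0-indexed: row i < size la, column j < nth 0 la i. *)
Definition arm (la : seq nat) (i j : nat) : nat := nth 0 la i - j.+1.

Definition leg (la : seq nat) (i j : nat) : nat :=
  count (fun r => j < r) (drop i.+1 la).

Definition hook_length (la : seq nat) (i j : nat) : nat :=
  arm la i j + leg la i j + 1.

Definition hook_set (la : seq nat) : set nat :=
  [set h | exists i j,
     [/\ i < size la, j < nth 0 la i & h = hook_length la i j]].

Definition partitions_of (S : set nat) : set (seq nat) :=
  [set la | is_partition la /\ hook_set la = ~` S].

Definition lambda_minimal (S : set nat) : Prop :=
  forall la, partitions_of S la -> sumn (enumeration S) <= sumn la.

Definition Smks (m k s : nat) : set nat :=
  [set j * m | j in [set j | j <= k]] `|` [set n | k * m + s + 1 <= n].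

(* Main.v *)
Require Import Defs.
From mathcomp Require Import all_boot finmap zify.
From mathcomp Require Import boolp classical_sets cardinality.

(** A partition la is the enumeration of a numerical set T, whose gaps are the
    hook lengths of the first column of la; the hooks of la are the positive
    differences g - t with t in T and g a gap, and the size of la is the number
    of such pairs (hook_setP, sumn_inversions).  If H(la) is the complement of
    S = S_{m,k,s}, then T contains S and S + T is contained in T.  In
    particular T is closed under adding m, hence it is determined by its Kunz
    coordinates: g_r is the number of gaps of T congruent to r modulo m, for
    0 <= r < m.

    In these coordinates the number of pairs (t, gap) with t congruent to a and
    the gap congruent to b is a triangular number,
    tri (g_b - g_a - [b <= a]), so that the size of la is
    W := sum over a, b of tri (g_b - g_a - [b <= a])   (inversions_kunz).
    With n_r := k + [r <= s], the semigroup S itself has g_0 = 0 and g_r = n_r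
    for r <> 0, so |lambda(S)| is the sum of the tri n_r over r <> 0
    (kunz_size_Smks).  For T one has g_0 = 0, g_s = k + 1 and g_r <= n_r.

    Compare the two sums one residue at a time.  In W, the pairs of residues
    (0, r) and (r, s) contribute tri g_r + tri (n_r - g_r), which falls short of
    tri n_r by g_r (n_r - g_r).  The deficit vanishes unless r is partial, that
    is 0 < g_r < n_r, and it is always at most tri k.  It is thus enough to find
    as many good pairs (a, b), with a <> 0, b <> s and a contribution of at
    least tri k to W, as there are partial residues.

    This is where H(la) must be all of the complement of S.  For each r <> 0 the
    largest gap of S congruent to r is a hook, and writing it as a difference
    gives r = b - a modulo m with g_a = 0 (the class of a lies in T), g_b = n_b
    (the class of b is disjoint from T up to F(T)), and a < b or b <= s, which
    makes the contribution of (a, b) at least tri k.  Let A be the set of the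
    r <> 0 with g_r = 0, called free below.  If r is partial or
    in A, then a <> 0, as otherwise r = b.  So the difference map sends the union of the good pairs and of
    A x {s} onto a set containing A and all partial residues, whence
    #|partial| + #|A| <= #|good| + #|A|  (card_partial_le_good). *)

Set Implicit Arguments.
Unset Strict Implicit.
Unset Printing Implicit Defensive.

(** * The numerical set of a partition *)

(** The first-column hook lengths of [la], which are the gaps of the numerical
    set that [la] enumerates. *)
Fixpoint gaps (la : seq nat) : seq nat :=
  if la is x :: l then x + size l :: gaps l else [::].

Lemma size_gaps la : size (gaps la) = size la.
Proof. by elim: la => //= x l ->. Qed.

Lemma gaps_gt0 la : 0 \notin la -> 0 \notin gaps la.
Proof.
elim: la => //= x l IH; rewrite !inE !negb_or => /andP[x0 /IH ->].
by rewrite andbT; lia.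
Qed.

Lemma sorted_gaps la : sorted geq la -> sorted gtn (gaps la).
Proof.
elim: la => //= x [|y l] //= IH /andP[/= yx /IH /= ->]; lia.
Qed.

Lemma gaps_lt x l g : sorted geq (x :: l) -> g \in gaps l -> g < x + size l.
Proof.
move=> /sorted_gaps /= xl.
suff /allP : all (gtn (x + size l)) (gaps l) by apply.
by apply: order_path_min xl => a b c /=; lia.
Qed.

Lemma gaps_uniq la : sorted geq la -> uniq (gaps la).
Proof. by move=> /sorted_gaps; apply: sorted_uniq => [a b c|a] /=; lia. Qed.

(** The place, in the profile of [l], of the horizontal step under the column
    [j]: it follows [j] other horizontal steps, and one vertical step for each
    row of length at most [j]. *)
Definition bead l j := j + count (fun r => r <= j) l.

Lemma bead_notin_gaps l j : sorted geq l -> bead l j \notin gaps l.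
Proof.
rewrite /bead; elim: l => //= x l IH xl.
have := IH (path_sorted xl); rewrite inE negb_or; case: leqP => xj.
  have -> : count (fun r => r <= j) l = size l.
    apply/eqP; rewrite -all_count; apply/allP => r rl.
    have /allP/(_ r rl) /= : all (geq x) l.
      by apply: order_path_min xl => a b c /=; lia.
    lia.
  move=> _; apply/andP; split; first lia.
  apply/negP => /(gaps_lt xl); lia.
rewrite add0n => ->; rewrite andbT.
have := count_size (fun r => r <= j) l; lia.
Qed.

Definition below (T : pred nat) x := [seq t <- iota 0 x | T t].

(** The beads are [x] distinct elements of the numerical set below its largest
    gap [x + size l]; since exactly [size l] of the numbers below [x + size l]
    are gaps, there are no others. *)
Lemma bead_row x l : sorted geq (x :: l) ->
  perm_eq (map (bead l) (iota 0 x))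
          (below (fun t => t \notin gaps (x :: l)) (x + size l)).
Proof.
move=> xl; have sl := path_sorted xl.
have unq : uniq (map (bead l) (iota 0 x)).
  rewrite map_inj_in_uniq ?iota_uniq // => i j _ _.
  wlog ij : i j / i < j => [hw|].
    case: (ltngtP i j) => // /hw; [exact | by move=> h /esym/h].
  rewrite /bead => eij.
  have : count (fun r => r <= i) l <= count (fun r => r <= j) l.
    by apply: sub_count => r /=; lia.
  lia.
suff [sub le_size] : {subset map (bead l) (iota 0 x)
      <= below (fun t => t \notin gaps (x :: l)) (x + size l)} /\
    size (below (fun t => t \notin gaps (x :: l)) (x + size l))
      <= size (map (bead l) (iota 0 x)).
  have [_ eqm] := uniq_min_size unq sub le_size.
  by apply: uniq_perm; rewrite ?filter_uniq ?iota_uniq.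
split.
  move=> t /mapP[j]; rewrite mem_iota => /andP[_ jx] ->.
  have lt : bead l j < x + size l.
    by rewrite /bead; have := count_size (fun r => r <= j) l; lia.
  by rewrite mem_filter mem_iota /= inE lt negb_or (bead_notin_gaps _ sl) neq_ltn lt.
rewrite size_map size_iota size_filter.
have /= := count_predC (fun t => t \in gaps l) (iota 0 (x + size l)).
have -> : count (fun t => t \in gaps l) (iota 0 (x + size l)) = size l.
  rewrite -size_filter -[RHS]size_gaps.
  apply: perm_size; apply: uniq_perm;
    rewrite ?filter_uniq ?iota_uniq ?gaps_uniq //.
  move=> g; rewrite mem_filter mem_iota /=; case: (boolP (g \in _)) => //=.
  by move/(gaps_lt xl).
rewrite size_iota => cnt.
rewrite -(leq_add2l (size l)) (addnC _ x) -[leqRHS]cnt leq_add2l.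
by apply: sub_count => t /=; rewrite inE negb_or => /andP[].
Qed.

(** The hook of the box [(0, j)] is the largest gap minus [bead l j], so
    [bead_row] gives the first row.  As for the other rows, a number below a
    smaller gap is not the largest gap, so that removing the first row does not
    change its membership in the numerical set. *)
Lemma hook_setP la h : sorted geq la ->
  hook_set la h <-> exists g t,
    [/\ g \in gaps la, t \notin gaps la, t < g & h = g - t].
Proof.
elim: la h => [|x l IH] h xl.
  split=> [[i [j [//]]]|[g [t [//]]]].
have sl := path_sorted xl.
have rowP := perm_mem (bead_row xl).
have hookE j : j < x -> hook_length (x :: l) 0 j = x + size l - bead l j.
  move=> jx; rewrite /hook_length /arm /leg /bead /= drop0.
  have := count_predC (fun r => r <= j) l.
  rewrite (eq_count (a1 := predC _) (a2 := fun r => j < r)); last first.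
    by move=> r /=; rewrite ltnNge.
  lia.
split.
- case=> [[|i]] [j [/= il jx ->]].
    have := rowP (bead l j); rewrite map_f ?mem_iota //= => /esym.
    rewrite mem_filter mem_iota => /andP[tn /andP[_ lt]].
    by exists (x + size l), (bead l j); rewrite hookE // inE eqxx tn lt.
  rewrite -[hook_length _ _ _]/(hook_length l i j).
  have [|g [t [gl tl tg ->]]] := (IH (hook_length l i j) sl).1; first by exists i, j.
  exists g, t; rewrite !inE gl orbT (negPf tl) orbF; split => //.
  by have := gaps_lt xl gl; lia.
- case=> g [t []]; rewrite !inE => /orP[/eqP->|gl].
    move=> tn tlt ->.
    have := rowP t; rewrite mem_filter mem_iota /= inE tn tlt => /mapP[j].
    rewrite mem_iota => /andP[_ jx] ->.
    by exists 0, j; split => //; rewrite hookE.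
  rewrite negb_or => /andP[_ tl] tg ->.
  have [|i [j [il jx ->]]] := (IH (g - t) sl).2; first by exists g, t.
  by exists i.+1, j.
Qed.

(** * Sizes as numbers of inversions *)

Definition inversions (T : pred nat) N :=
  \sum_(t < N) \sum_(g < N) ([&& T t, ~~ T g & t < g] : nat).

Lemma size_below T N x : x <= N ->
  size (below T x) = \sum_(t < N) (T t && (t < x) : nat).
Proof.
move=> xN; rewrite size_filter -sum1_count.
rewrite -{1}(subn0 x) -/(index_iota 0 x) big_mkord.
rewrite (big_ord_widen_cond _ T (fun=> 1) xN) big_mkcond.
by apply: eq_bigr => t _; case: (T t && _).
Qed.

Lemma inversionsE (T : pred nat) N :
  inversions T N = \sum_(g <- iota 0 N | ~~ T g) size (below T g).
Proof.
rewrite /inversions exchange_big /= (_ : iota 0 N = index_iota 0 N); last first.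
  by rewrite /index_iota subn0.
rewrite big_mkord.
rewrite [RHS]big_mkcond; apply: eq_bigr => g _.
rewrite (size_below _ (ltnW (ltn_ord g))).
case: (T g) => /=; first by rewrite big1 // => t _; rewrite andbF.
by apply: eq_bigr.
Qed.

Lemma sumn_inversions la N :
    sorted geq la -> (forall g, g \in gaps la -> g < N) ->
  sumn la = inversions (fun t => t \notin gaps la) N.
Proof.
move=> sla laN; rewrite inversionsE -big_filter.
rewrite (perm_big (gaps la)) /=; last first.
  apply: uniq_perm; rewrite ?filter_uniq ?iota_uniq ?gaps_uniq //.
  move=> g; rewrite mem_filter mem_iota /= negbK.
  by case: (boolP (g \in _)) => //= /laN.
elim: la sla {laN} => [|x l IH] xl; first by rewrite big_nil.
rewrite big_cons -(perm_size (bead_row xl)) size_map size_iota /=.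
rewrite IH ?(path_sorted xl) //; congr (_ + _).
apply: eq_big_seq => g /(gaps_lt xl) gx; congr size.
apply: eq_in_filter => t; rewrite mem_iota /= => tg.
by rewrite inE negb_or neq_ltn (ltn_trans tg gx).
Qed.

Lemma sumn_enumeration (T : pred nat) N : (forall g, ~~ T g -> g < N) ->
  sumn (enumeration [set x | T x]%classic) = inversions T N.
Proof.
move=> TN; rewrite inversionsE /enumeration.
have finI x (A : set nat) : (forall u, A u -> u < x) -> finite_set A.
  by move=> Ax; apply: (sub_finite_set _ (finite_II x)) => u /Ax.
rewrite (perm_sumn (permEl (perm_sort _ _))) sumnE big_map.
rewrite -[RHS]big_filter [LHS](perm_big [seq g <- iota 0 N | ~~ T g]) /=; last first.
  apply: uniq_perm; rewrite ?filter_uniq ?iota_uniq ?fset_uniq // => g.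
  rewrite [RHS]mem_filter mem_iota in_fset_set; last first.
    by apply: (finI N) => u /negP/TN.
  apply/idP/idP; first by rewrite inE => /negP nTg; rewrite nTg TN.
  by case/andP => nTg _; rewrite inE; apply/negP.
apply: eq_bigr => g _; apply: perm_size.
apply: uniq_perm; rewrite ?filter_uniq ?iota_uniq ?fset_uniq // => u.
rewrite [RHS]mem_filter mem_iota in_fset_set; last by apply: (finI g) => v [].
apply/idP/idP; first by rewrite inE => -[-> ->].
by case/andP => Tu ug; rewrite inE; split.
Qed.

(** * Triangular numbers *)

Definition tri n := 'C(n.+1, 2).

Lemma triS n : tri n.+1 = tri n + n.+1.
Proof. by rewrite /tri binS bin1 addnC. Qed.

Lemma triD p q : tri (p + q) = tri p + tri q + p * q.
Proof.
elim: q => [|q IH]; first by rewrite muln0 !addn0.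
by rewrite addnS !triS IH mulnS; lia.
Qed.

Lemma leq_tri p q : p <= q -> tri p <= tri q.
Proof. by move=> /subnKC <-; rewrite triD -addnA leq_addr. Qed.

(** Indeed [tri (p + q).-1 = p * q + tri p.-1 + tri q.-1]. *)
Lemma leq_mul_tri p q k : 0 < p -> 0 < q -> p + q <= k.+1 -> p * q <= tri k.
Proof.
case: p => // p _; case: q => // q _ le_pq.
have /leq_tri : (p + q).+1 <= k by lia.
by apply: leq_trans; rewrite triS triD; lia.
Qed.

Lemma sum_interval K p q : \sum_(i < K) (p <= i < q : nat) = minn q K - p.
Proof. by elim: K => [|K IH]; rewrite ?big_ord0 ?big_ord_recr /= ?IH; lia. Qed.

Lemma sum_shifted_pairs K p q d : q <= K ->
  \sum_(i < K) \sum_(j < K) ([&& p <= i, ~~ (q <= j) & i + d <= j] : nat)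
    = tri (q - p - d).
Proof.
move=> leqK; rewrite exchange_big /=.
transitivity (\sum_(j < K) (if j < q then j.+1 - d - p else 0)).
  apply: eq_bigr => j _; case: ltnP => [ltjq|_]; last first.
    by rewrite big1 // => i _; rewrite andbF.
  transitivity (\sum_(i < K) (p <= i < j.+1 - d : nat)).
    by apply: eq_bigr => i _; congr nat_of_bool; lia.
  by rewrite sum_interval; have := ltn_ord j; lia.
rewrite -big_mkcond /= -(big_ord_widen _ (fun j => j.+1 - d - p) leqK).
elim: {leqK} q => [|q IH]; first by rewrite big_ord0.
rewrite big_ord_recr /= IH.
have [le|lt] := leqP (p + d) q; last first.
  have -> : q.+1 - d - p = 0 by lia.
  by rewrite addn0; congr tri; lia.
have -> : q.+1 - p - d = (q - p - d).+1 by lia.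
by rewrite triS; lia.
Qed.

(** * Kunz coordinates *)

(** If [T] is closed under adding [m] and contains [r + n * m], this is the
    number of gaps of [T] in the class of [r] modulo [m]. *)
Definition kunz (T : pred nat) m n r := find (fun j => T (r + j * m)) (iota 0 n).

Lemma kunz_le (T : pred nat) m n r : kunz T m n r <= n.
Proof. by rewrite -[leqRHS](size_iota 0 n) find_size. Qed.

Lemma kunzP (T : pred nat) m n r j :
    (forall t, T t -> T (t + m)) -> T (r + n * m) ->
  T (r + j * m) = (kunz T m n r <= j).
Proof.
move=> Tm Tn.
have up i d : T (r + i * m) -> T (r + (i + d) * m).
  elim: d => [|d IH] Ti; first by rewrite addn0.
  by rewrite addnS mulSnr addnA Tm ?IH.
have Tk : T (r + kunz T m n r * m).
  have := kunz_le T m n r; rewrite leq_eqVlt => /orP[/eqP-> //|lt].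
  have := @nth_find _ 0 (fun j => T (r + j * m)) (iota 0 n).
  by rewrite has_find size_iota nth_iota // => /(_ lt).
case: leqP => [/subnKC <-|lt]; first exact: up.
have := before_find 0 lt; rewrite nth_iota //.
exact: leq_trans lt (kunz_le _ _ _ _).
Qed.

Definition kunz_size m (g : nat -> nat) :=
  \sum_(a < m) \sum_(b < m) tri (g b - g a - (b <= a)).

Lemma sum_residues m K (F : nat -> nat) :
  \sum_(x < K * m) F x = \sum_(a < m) \sum_(i < K) F (a + i * m).
Proof.
rewrite exchange_big /= -(big_mkord xpredT F) big_nat_mul big_mkord.
apply: eq_bigr => i _.
rewrite -{1}[i * m]add0n big_addn mulSn addnK big_mkord.
by apply: eq_bigr.
Qed.

(** An element [a + i * m] precedes [b + j * m] when [i <= j] if [a < b], and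
    when [i < j] if [b <= a]: this is the shift by [b <= a].  Hence the pairs
    of the classes of [a] and [b] are those counted by [sum_shifted_pairs]. *)
Lemma inversions_kunz m K (T : pred nat) (g : nat -> nat) :
    (forall r, r < m -> g r <= K) ->
    (forall r j, r < m -> T (r + j * m) = (g r <= j)) ->
  inversions T (K * m) = kunz_size m g.
Proof.
move=> gK gT.
rewrite /inversions (sum_residues _ _
  (fun t => \sum_(x < K * m) ([&& T t, ~~ T x & t < x] : nat))).
apply: eq_bigr => a _.
under eq_bigr => i _ do rewrite (sum_residues _ _
  (fun x => [&& T (a + i * m), ~~ T x & a + i * m < x] : nat)).
rewrite exchange_big /=; apply: eq_bigr => b _.
rewrite -(@sum_shifted_pairs K) ?gK //.
apply: eq_bigr => i _; apply: eq_bigr => j _.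
rewrite !gT //; congr (nat_of_bool [&& _, _ & _]).
have := ltn_ord a; have := ltn_ord b; case: (leqP b a) => ba ltb lta.
  by rewrite addn1; apply/idP/idP => ?; nia.
by rewrite addn0; apply/idP/idP => ?; nia.
Qed.

(** Only the pairs [(0, r)] contribute: for [a, b > 0], [g b] can exceed [g a]
    only when [b <= s < a], by one, and the shift by [b <= a] removes it. *)
Lemma kunz_size_Smks m k s (g : nat -> nat) :
    (forall r, g r = if r == 0 then 0 else k + (r <= s)) ->
  kunz_size m.+1 g = \sum_(r < m.+1 | r != ord0) tri (k + (r <= s)).
Proof.
move=> gE; rewrite /kunz_size (bigD1 ord0) //= [X in _ + X]big1 ?addn0.
  rewrite (bigD1 ord0) //= !gE /= add0n; apply: eq_bigr => r r0.
  have r1 : (r : nat) != 0 by apply: contra r0 => /eqP r0; apply/eqP/val_inj.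
  by rewrite !gE (negPf r1) /= !subn0 leqn0 (negPf r1) subn0.
move=> a a0; have a1 : (a : nat) != 0.
  by apply: contra a0 => /eqP a0; apply/eqP/val_inj.
rewrite big1 // => b _; rewrite !gE (negPf a1).
by case: eqP => b1; rewrite (_ : _ - _ - _ = 0) //; lia.
Qed.

(** * The lower bound *)

Section LowerBound.
Variables (m k s : nat) (g : nat -> nat).
Hypothesis k_gt0 : 0 < k.
Hypothesis s_bd : 0 < s <= m.
Hypothesis g0 : g 0 = 0.
Hypothesis gs : g s = k.+1.
Hypothesis g_le : forall r, r <= m -> g r <= k + (r <= s).
(** The last condition says that [r = b - a] modulo [m.+1], with [a < b] or
    [b <= s]. *)
Hypothesis differences : forall r, 0 < r <= m -> exists a b,
  [/\ a <= m, b <= m, g a = 0, g b = k + (b <= s)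
    & a + r = b \/ (a + r = b + m.+1 /\ b <= s)].

Let I := 'I_m.+1.
Let partial := [set r : I | 0 < g r < k + (r <= s)].
Let free := [set r : I | (r != ord0) && (g r == 0)].
Let os : I := inord s.
Let good := [set ab : I * I | [&& ab.1 != ord0, ab.2 != os
                                 & k + (ab.2 <= ab.1) + g ab.1 <= g ab.2]].

(** The residues that are partial or free are all differences [b - a] with [a]
    free, and [(a, b)] is then a good pair or [b = s]; there are only
    [#|free|] pairs of the latter kind. *)
Lemma card_partial_le_good : #|partial| <= #|good|.
Proof.
have osE : os = s :> nat by rewrite inordK; lia.
pose dif (ab : I * I) : I := inord ((ab.2 + m.+1 - ab.1) %% m.+1).
pose fs := [set (a, os) | a in free].
have /subset_leq_card :
    partial :|: free \subset [set dif ab | ab in good :|: fs].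
  apply/fintype.subsetP => r; rewrite !inE => Hr.
  have r_gt0 : 0 < r.
    by case: (posnP r) Hr => // r0; rewrite r0 g0 /= => /andP[/eqP[]]; apply: val_inj.
  have r_lt := ltn_ord r.
  have [|a [b [lea leb ga gb ab]]] := differences (r := r); first by lia.
  have rE : r = dif (inord a, inord b).
    apply: val_inj; rewrite /= !inordK ?ltn_mod ?ltnS //.
    case: ab => [<-|[abE _]].
      by rewrite (_ : _ + _ - _ = r + m.+1) ?modnDr ?modn_small //; lia.
    by rewrite (_ : _ + _ - _ = r) ?modn_small //; lia.
  (* If [a = 0] then [r = b], which is neither partial nor free. *)
  have a_gt0 : 0 < a.
    rewrite lt0n; apply/eqP => a0; subst a.
    have br : b = r by lia.
    move: Hr; rewrite -br gb ltnn andbF /=; lia.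
  apply/imsetP; exists (inord a, inord b) => //.
  have a_n0 : (inord a : I) != ord0.
    by apply/eqP => /(congr1 val) /=; rewrite inordK //; lia.
  rewrite inE; have [bs|bs] := eqVneq (inord b : I) os.
    apply/orP; right; apply/imsetP; exists (inord a); last by rewrite bs.
    by rewrite inE a_n0 inordK ?ga.
  rewrite inE /= a_n0 bs !inordK //= ga gb.
  apply/orP; left; lia.
have disj : [disjoint partial & free].
  by rewrite -setI_eq0; apply/eqP/setP => r; rewrite !inE; lia.
rewrite cardsU disjoint_setI0 // cards0 subn0 => le1.
have le2 := leq_imset_card dif (mem (good :|: fs)).
have le3 := (leq_card_setU good fs).1.
have le4 : #|fs| <= #|free| := leq_imset_card _ _.
have := leq_trans le1 (leq_trans le2 le3); lia.
Qed.

(** The pairs [(0, r)] and [(r, s)] together miss [tri (k + (r <= s))] by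
    [g r * (k + (r <= s) - g r)], which is at most [tri k] and nonzero only for
    partial [r]; each partial residue is compensated by a good pair. *)
Lemma kunz_size_lower_bound :
  \sum_(r < m.+1 | r != ord0) tri (k + (r <= s)) <= kunz_size m.+1 g.
Proof.
have osE : os = s :> nat by rewrite inordK; lia.
pose W a b := tri (g b - g a - (b <= a)).
have -> : kunz_size m.+1 g = \sum_(b : I) W 0 b +
    (\sum_(a : I | a != ord0) W a s +
     \sum_(a : I | a != ord0) \sum_(b : I | b != os) W a b).
  rewrite /kunz_size (bigD1 ord0) //= -big_split /=; congr (_ + _).
  by apply: eq_bigr => a _; rewrite (bigD1 os) //= osE.
rewrite (bigD1 ord0 (P := xpredT)) // -[leqRHS]addnA.
apply: leq_trans (leq_addl (W 0 0) _); rewrite addnA -big_split /=.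
have le_good : #|partial| * tri k <=
    \sum_(a : I | a != ord0) \sum_(b : I | b != os) W a b.
  apply: (@leq_trans (#|good| * tri k)).
    by rewrite leq_mul2r card_partial_le_good orbT.
  rewrite pair_big_dep /= -sum_nat_const.
  rewrite (bigID (mem good) (fun ab : I * I => _ && _)) /=.
  apply: leq_trans (leq_addr _ _).
  rewrite [X in X <= _](eq_bigl (fun ab : I * I =>
    (ab.1 != ord0) && (ab.2 != os) && (ab \in good))); last first.
    by move=> ab; rewrite inE; case: (_ != ord0); case: (_ != os).
  apply: leq_sum => -[a b] /andP[_]; rewrite inE /= => /and3P[_ _ ab].
  by apply: leq_tri; lia.
apply: leq_trans (leq_add (leqnn _) le_good).
have -> : #|partial| * tri k = \sum_(r : I | r != ord0) (r \in partial) * tri k.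
  rewrite -big_distrl /= -sum1_card; congr (_ * _).
  rewrite big_mkcond [RHS]big_mkcond; apply: eq_bigr => r _.
  case: eqVneq => [->|]; first by rewrite inE g0.
  by case: (_ \in _).
rewrite -big_split; apply: leq_sum => r r0 /=.
have r_gt0 : 0 < r by rewrite lt0n; apply: contra r0 => /eqP r0; apply/eqP/val_inj.
have grle := g_le (r := r) (ltnSE (ltn_ord r)).
rewrite /W g0 gs subn0 leqn0 (gtn_eqF r_gt0) subn0.
have [rs|rs] := eqVneq (r : nat) s.
  by rewrite rs gs leqnn addn1 -addnA leq_addr.
rewrite (_ : k.+1 - _ - _ = k + (r <= s) - g r); last by lia.
rewrite -{1}(subnKC grle) triD -addnA -addnA !leq_add2l inE.
case: (posnP (g r)) => [->|gr_gt0]; first by rewrite mul0n.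
case: ltnP => [gr_lt|]; last first.
  by move=> ?; rewrite (_ : _ - g r = 0) ?muln0 //; lia.
by rewrite mul1n; apply: leq_mul_tri; lia.
Qed.
End LowerBound.

(** * The semigroups S_{m,k,s} *)

Definition in_Smks m k s : pred nat := fun n => (m %| n) || (k * m + s < n).

Lemma SmksE m k s : 0 < s < m -> Smks m k s = [set n | in_Smks m k s n]%classic.
Proof.
move=> sm; apply/seteqP; rewrite /in_Smks; split => n /=.
  case=> [[j _ <-]|]; first by rewrite dvdn_mull.
  by rewrite /= addn1 => ->; rewrite orbT.
case: (ltnP (k * m + s) n) => [lt _|le]; first by right; rewrite /= addn1.
rewrite orbF => /dvdnP[j nE]; left; exists j => //=.
rewrite leqNgt; apply/negP => kj; nia.
Qed.

Lemma in_Smks_residue m k s r j : 0 < s < m -> r < m ->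
  in_Smks m k s (r + j * m) = ((if r == 0 then 0 else k + (r <= s)) <= j).
Proof.
move=> sm rm; rewrite /in_Smks [r + _]addnC dvdn_addr ?dvdn_mull //.
case: (posnP r) => [->|r0]; first by rewrite dvdn0.
rewrite gtnNdvd //=; case: leqP => rs; apply/idP/idP => ?; nia.
Qed.

Lemma numerical_semigroup_Smks m k s : 0 < s < m -> numerical_semigroup (Smks m k s).
Proof.
move=> sm; rewrite SmksE //; split; first split.
- by rewrite /= /in_Smks dvdn0.
- apply: (sub_finite_set _ (finite_II (k * m + s).+1)) => n /= /negP.
  by rewrite negb_or -leqNgt => /andP[].
- move=> a b /= /orP[da|la] /orP[db|lb]; apply/orP.
  + by left; rewrite dvdn_add.
  + by right; lia.
  + by right; lia.
  + by right; lia.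
Qed.

Lemma sumn_enumeration_Smks m k s : 0 < s < m.+1 ->
  sumn (enumeration (Smks m.+1 k s))
  = \sum_(r < m.+1 | r != ord0) tri (k + (r <= s)).
Proof.
move=> sm; pose g r := if r == 0 then 0 else k + (r <= s).
rewrite SmksE // (@sumn_enumeration _ (k.+1 * m.+1)).
  rewrite (@inversions_kunz _ _ _ g).
  - exact: kunz_size_Smks.
  - by move=> r _; rewrite /g; case: eqP => // _; lia.
  - by move=> r j rm; rewrite in_Smks_residue.
by move=> n; rewrite negb_or -leqNgt => /andP[_]; nia.
Qed.

Lemma lambda_minimal_Smks m k s : 0 < k -> 0 < s < m -> lambda_minimal (Smks m k s).
Proof.
case: m => [|m] k_gt0 sm la; first by lia.
rewrite sumn_enumeration_Smks // SmksE // => -[[sla la0] hookE].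
pose T t := t \notin gaps la.
have hookP h : ~~ in_Smks m.+1 k s h <->
    exists t, [/\ T t, ~~ T (t + h) & 0 < h].
  have := hook_setP h sla; rewrite hookE /= /T => hP; split.
    move=> /negP /hP[g [t [gl tl tg ->]]]; exists t.
    by rewrite (subnKC (ltnW tg)) negbK subn_gt0.
  move=> [t [tl]]; rewrite negbK => thl h0; apply/negP/hP.
  by exists (t + h), t; rewrite addKn; split => //; lia.
have T0 : T 0 by exact: gaps_gt0.
have T_add t x : T t -> in_Smks m.+1 k s x -> T (t + x).
  move=> Tt Sx; case: (posnP x) => [->|x0]; first by rewrite addn0.
  by apply: contraLR Sx => ntx; apply/hookP; exists t.
have T_big x : k * m.+1 + s < x -> T x.
  by move=> xb; rewrite -[x]add0n T_add // /in_Smks xb orbT.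
have Tm t : T t -> T (t + m.+1) by move=> Tt; rewrite T_add // /in_Smks dvdnn.
pose g := kunz T m.+1 k.+1.
have gP r j : T (r + j * m.+1) = (g r <= j) by apply: kunzP => //; apply: T_big; nia.
(* [r + (k + (r <= s)).-1 * m.+1] is the largest gap of S congruent to [r]. *)
have hookr r : 0 < r <= m -> exists t, [/\ T t &
    ~~ T (t + (r + (k + (r <= s)).-1 * m.+1))].
  move=> /andP[r0 rm].
  have /hookP[t [Tt nT _]] : ~~ in_Smks m.+1 k s (r + (k + (r <= s)).-1 * m.+1).
    by rewrite in_Smks_residue // gtn_eqF // -ltnNge prednK //; lia.
  by exists t.
have le_F x : ~~ T x -> x <= k * m.+1 + s.
  by move=> nT; rewrite leqNgt; apply: contra nT => /T_big.
rewrite (@sumn_inversions _ (k.+1 * m.+1)) //; last first.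
  by move=> x xl; have := le_F x; rewrite /T negbK => /(_ xl); nia.
rewrite (@inversions_kunz _ _ _ g);
  [|by move=> r _; exact: kunz_le|by move=> r j _; exact: gP].
have g_le r : r <= m -> g r <= k + (r <= s).
  by move=> rm; rewrite -gP T_big //; case: leqP => rs; nia.
have g_full b : b <= m -> ~~ T (b + (k + (b <= s)).-1 * m.+1) ->
    g b = k + (b <= s).
  move=> bm; rewrite gP -ltnNge => ?.
  by apply/eqP; rewrite eqn_leq g_le //; lia.
have g_free a : T a -> g a = 0.
  by move=> Ta; have := gP a 0; rewrite addn0 Ta leqn0 => /esym/eqP.
apply: kunz_size_lower_bound => //.
- by apply: g_free.
(* For [r = s] that gap is F(S), and no gap of T is larger, so [t = 0]. *)
- have [|t [Tt nT]] := hookr s; first by lia.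
  have := le_F _ nT; rewrite leqnn addn1 /= => le.
  have t0 : t = 0 by lia.
  by rewrite g_full ?leqnn ?addn1 //=; [lia | move: nT; rewrite t0 add0n leqnn addn1].
move=> r rm; have [t [Tt nT]] := hookr r rm.
have leF := le_F _ nT.
(* No gap of T exceeds F(S), so the gap [h] of S fixed by [r] and the [t] with
   [t + h] a gap of T satisfy [t < m.+1]: [t] is its own residue, whence
   [g t = 0]. *)
have [rs|sr] := leqP r s.
  have tr : t + r <= s by move: leF; rewrite rs addn1 /=; lia.
  exists t, (t + r); rewrite g_free // g_full; [|lia|].
    by split; [lia|lia| | |left].
  by move: nT; rewrite rs tr addn1 addnA.
move: nT leF; rewrite leqNgt sr addn0 => nT leF.
have ltm : t + r <= m + s.+1 by nia.
have [trm|mtr] := leqP (t + r) m.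
  exists t, (t + r); rewrite g_free // g_full //; first by split; [lia|lia| | |left].
  by rewrite leqNgt (leq_trans sr (leq_addl _ _)) addn0 -addnA.
have brs : t + r - m.+1 <= s by lia.
exists t, (t + r - m.+1); rewrite g_free // g_full; [|lia|].
  by split; [lia|lia| | |right; split; lia].
rewrite brs addn1 /=; apply: contra nT.
by rewrite (_ : _ + k * _ = t + (r + k.-1 * m.+1)) //; case: (k) k_gt0 => // k' _; lia.
Qed.

Theorem theorem1p5 (m k s : nat) (hm : 2 <= m) (hk : 1 <= k)
    (hs : 1 <= s <= m - 1) :
  numerical_semigroup (Smks m k s) /\ lambda_minimal (Smks m k s).
Proof.
have sm : 0 < s < m by lia.
by split; [exact: numerical_semigroup_Smks | exact: lambda_minimal_Smks].
Qed.
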